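(* Let $q$ be a prime power and let $Z$ and $\mathcal{L}_3$ be the surface over $\mathbf{F}_q$ and the line bundle described in the context. The code $C_L(Z,\mathcal{L}_3)$ has parameters $$[q^2+q+1,\ 7,\ q^2-q-1],$$ i.e. length $q^2+q+1$, dimension $7$ and minimum distance $q^2-q-1$.
   Context: Let $P$ be a closed point of degree $3$ of $\mathbf{P}^2$ over $\mathbf{F}_q$ which is not contained in any line defined over $\mathbf{F}_q$ (so over $\mathbf{F}_{q^3}$ it splits into three non collinear Frobenius-conjugate points). Let $\pi:Z\to\mathbf{P}^2$ be the blow up of $\mathbf{P}^2$ at $P$, with exceptional divisor $E$. Let $\Gamma_3$ be the linear system of plane curves of degree $3$ containing $P$, and let $\mathcal{L}_3$ be the line bundle on $Z$ associated to $\pi^{\star}\Gamma_3-E$ (so $\mathcal{L}_3\cong\mathcal{O}_Z(3\pi^{\star}L-E)$ with $L$ a line of $\mathbf{P}^2$). For a line bundle $\mathcal{L}$ on a smooth projective geometrically irreducible surface $X$ over $\mathbf{F}_q$ with rational points $X(\mathbf{F}_q)=\{P_1,\dots,P_n\}$ (all of them), the code $C_L(X,\mathcal{L})\subset \mathbf{F}_q^n$ is the image of the evaluation map $H^0(X,\mathcal{L})\to\bigoplus_i \mathcal{L}_{P_i}\simeq\mathbf{F}_q^n$, $f\mapsto (f_{P_1},\dots,f_{P_n})$, where a coordinate has been chosen on each fibre (different choices give codes isometric for the Hamming distance). A code with parameters $[n,k,d]$ has length $n$, dimension $k$ and minimum Hamming distance $d$. *)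

(* Defs.v *)
From HB Require Import structures.
From mathcomp Require Import all_boot all_order all_algebra all_field.
From mathcomp Require Import mpoly.

Set Implicit Arguments.
Unset Strict Implicit.
Unset Printing Implicit Defensive.

Import GRing.Theory.
Local Open Scope ring_scope.

(* S = F[x_0, x_1, x_2].  A closed point of P^2 is given by homogeneous
   coordinates P : 'I_3 -> L over a finite extension L of F; it is the point
   whose homogeneous prime ideal I is generated by the forms of S vanishing
   at P.

   Z is the blow-up of P^2 along the ideal sheaf of I, i.e. the relative Proj
   of the Rees algebra.  In bihomogeneous terms Z = BiProj R, where
     R = \bigoplus_k I^k t^k  (a subring of S[t]),
   a form f of degree a in I^k giving the element f t^k of bidegree (a, k),
   with irrelevant ideals (x_0, x_1, x_2) and (g t : g in I).
   Since I . O_Z = O_Z(-E) = O_Z(0, 1), one has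
     O_Z(a pi^*H - m E) = O_Z(a, m) for H a line of P^2. *)

Definition eval_at (F : fieldType) (L : fieldExtType F) (P : 'I_3 -> L)
  (f : {mpoly F[3]}) : L := mmap (in_alg L) P f.

(* The second clause says that L is the residue field of the point. *)
Definition closed_point_of_degree (F : fieldType) (L : fieldExtType F)
  (P : 'I_3 -> L) (e : nat) : Prop :=
  \dim {:L} = e /\
  (exists2 i : 'I_3, P i != 0 &
     <<1 & [seq P j / P i | j : 'I_3]>>%VS = {:L}%VS).

Definition form_through (F : fieldType) (L : fieldExtType F) (P : 'I_3 -> L)
  (d : nat) (f : {mpoly F[3]}) : Prop :=
  f \is d.-homog /\ eval_at P f = 0.

Definition not_on_a_line (F : fieldType) (L : fieldExtType F)
  (P : 'I_3 -> L) : Prop :=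
  forall f : {mpoly F[3]}, f != 0 -> ~ form_through P 1 f.

(* f \in I^k *)
Definition ideal_pow (F : fieldType) (L : fieldExtType F) (P : 'I_3 -> L)
  (k : nat) (f : {mpoly F[3]}) : Prop :=
  exists (r : nat) (c : 'I_r -> {mpoly F[3]})
         (g : 'I_r -> 'I_k -> {mpoly F[3]}),
    (forall i j, exists d, form_through P d (g i j)) /\
    f = \sum_(i < r) c i * \prod_(j < k) g i j.

(* The piece of bidegree (d, k) of R. *)
Definition rees_piece (F : fieldType) (L : fieldExtType F) (P : 'I_3 -> L)
  (d k : nat) (f : {mpoly F[3]}) : Prop :=
  f \is d.-homog /\ ideal_pow P k f.

(* Representatives of the F-rational points of Z: the F-algebra morphisms
   R -> F, f t^k |-> ev k f, that do not kill either irrelevant ideal.  Only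
   the values of ev k on I^k are meaningful. *)
Definition rational_point (F : fieldType) (L : fieldExtType F)
  (P : 'I_3 -> L) (ev : nat -> {mpoly F[3]} -> F) : Prop :=
  [/\ forall c : F, ev 0%N c%:MP = c,
      forall k f g, ideal_pow P k f -> ideal_pow P k g ->
        ev k (f + g) = ev k f + ev k g,
      forall k l f g, ideal_pow P k f -> ideal_pow P l g ->
        ev (k + l)%N (f * g) = ev k f * ev l g,
      exists i : 'I_3, ev 0%N 'X_i != 0
    & exists (d : nat) (g : {mpoly F[3]}),
        form_through P d g /\ ev 1%N g != 0].

(* Two representatives define the same point of Z when they differ by the
   action of the torus G_m^2 of the bigrading. *)
Definition same_point (F : fieldType) (L : fieldExtType F)
  (P : 'I_3 -> L) (ev ev' : nat -> {mpoly F[3]} -> F) : Prop :=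
  exists lambda mu : F,
    [/\ lambda != 0, mu != 0 &
        forall a k f, rees_piece P a k f ->
          ev' k f = lambda ^+ a * mu ^+ k * ev k f].

Definition enumerates_rational_points (F : fieldType) (L : fieldExtType F)
  (P : 'I_3 -> L) (n : nat) (pts : 'I_n -> nat -> {mpoly F[3]} -> F) : Prop :=
  [/\ forall i, rational_point P (pts i),
      forall i j, same_point P (pts i) (pts j) -> i = j
    & forall ev, rational_point P ev -> exists i, same_point P (pts i) ev].

(* H^0(Z, O_Z(a pi^*H - m E)).  Z is integral, so a global section is an
   element s t^m, s \in Frac S, of the generic stalk that lies in the
   bidegree (a, m) part of the localization R_h for every member D_+(h) of
   the affine cover of Z given by h = x_i g t, g a nonzero form in I. *)
Definition global_section (F : fieldType) (L : fieldExtType F)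
  (P : 'I_3 -> L) (a m : nat) (s : {fraction {mpoly F[3]}}) : Prop :=
  forall (i : 'I_3) (b : nat) (g : {mpoly F[3]}),
    form_through P b g -> g != 0 ->
    exists (N : nat) (A : {mpoly F[3]}),
      rees_piece P (a + N * b.+1) (m + N) A /\
      s = tofrac A / tofrac (('X_i * g) ^+ N).

(* The value of s at the point represented by ev.  The representative fixes
   the coordinate on the fibre of the line bundle: scaling it by (lambda, mu)
   scales the coordinate by lambda^a mu^m. *)
Definition section_value (F : fieldType) (L : fieldExtType F)
  (P : 'I_3 -> L) (a m : nat) (ev : nat -> {mpoly F[3]} -> F)
  (s : {fraction {mpoly F[3]}}) (v : F) : Prop :=
  exists (i : 'I_3) (b : nat) (g : {mpoly F[3]}) (N : nat) (A : {mpoly F[3]}),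
    [/\ form_through P b g,
        ev 0%N 'X_i * ev 1%N g != 0,
        rees_piece P (a + N * b.+1) (m + N) A,
        s = tofrac A / tofrac (('X_i * g) ^+ N)
      & v = ev (m + N)%N A / (ev 0%N 'X_i * ev 1%N g) ^+ N].

Definition evaluation_code (F : fieldType) (L : fieldExtType F)
  (P : 'I_3 -> L) (a m : nat) (n : nat)
  (pts : 'I_n -> nat -> {mpoly F[3]} -> F) (c : 'rV[F]_n) : Prop :=
  exists2 s, global_section P a m s &
    forall i, section_value P a m (pts i) s (c 0 i).

Definition hamming_dist (F : fieldType) (n : nat) (c c' : 'rV[F]_n) : nat :=
  #|[set i | c 0 i != c' 0 i]|.

Definition has_parameters (F : fieldType) (n : nat) (C : 'rV[F]_n -> Prop)
  (len k d : nat) : Prop :=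
  n = len /\
  exists V : {vspace 'rV[F]_n},
    [/\ forall c, C c <-> c \in V,
        \dim V = k,
        exists c c', [/\ c \in V, c' \in V, c != c' & hamming_dist c c' = d]
      & forall c c', c \in V -> c' \in V -> c != c' ->
          (d <= hamming_dist c c')%N].

(* Main.v *)
Require Import Defs.
From HB Require Import structures.
From mathcomp Require Import all_boot all_order all_algebra all_field.
From mathcomp Require Import mpoly ring zify.

Set Implicit Arguments.
Unset Strict Implicit.
Unset Printing Implicit Defensive.

Import GRing.Theory.
Local Open Scope ring_scope.

(** The coordinates P_0, P_1, P_2 of the point are a basis of L over F: they
    are free because P lies on no line, and L has degree 3.  So evaluation at
    P identifies linear forms with L ([linear_form_onto]), and for linear forms
    l, l0 with l0 nonzero there is a linear form m with l^2 - l0 m vanishing at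
    P ([conic_through]).  These conics supply every curve through P that has to
    be exhibited, except for one binary form.

    Points.  A rational point of the blow-up is an evaluation of the Rees
    algebra.  It restricts to evaluation at a vector v of F^3 on forms, and
    since some conic through P does not vanish at v ([conic_avoiding]), the
    values on the powers of the ideal I of P are f(v) kappa^k for one nonzero
    kappa ([rational_point_eval]).  Hence the rational points of Z are those
    of the projective plane.

    Sections.  A section of 3 pi^*H - E, written with two coprime denominators,
    is a polynomial ([section_polynomial]).  Writing it with a denominator
    that vanishes to order exactly one at P shows that this cubic form
    vanishes at P ([section_cubic]).  So, up to nonzero factors, the code
    evaluates the cubics through P at the points of the plane
    ([evaluation_codeE]).  These cubics form a space of dimension 10 - 3 = 7.

    Weights.  A plane curve of degree d without F-rational line has at most
    (d - 1)(q + 1) rational points: each of the q + 1 lines through a rational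
    point p of the curve meets it in at most d - 1 further points, and a
    tangent line at p in at most d - 2 ([linear_factor_or_few_zeros]; the count
    is made with vectors, hence the factor q - 1).  A cubic through P either
    has no line, or is a line plus a conic through P, and such a conic contains
    no line because P lies on none.  In both cases it has at most 2 q + 2
    points ([cubic_zeros]).  A conic together with a line missing its rational
    points attains this bound ([extremal_cubic]).  As 2 q + 2 < q^2 + q + 1,
    evaluation is injective, and the minimum distance is
    q^2 + q + 1 - (2 q + 2) = q^2 - q - 1. *)

(** * Forms and substitutions *)

Lemma mpoly_ring_ind (n : nat) (R : nzRingType) (Q : {mpoly R[n]} -> Prop) :
  (forall c, Q c%:MP) -> (forall i, Q 'X_i) ->
  (forall f g, Q f -> Q g -> Q (f + g)) ->
  (forall f g, Q f -> Q g -> Q (f * g)) ->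
  forall f, Q f.
Proof.
move=> QC QX QD QM f.
rewrite [f]mpolyE; apply: big_ind => [||m _]; first by rewrite -mpolyC0; apply: QC.
  by [].
rewrite -mul_mpolyC; apply: (QM) => //.
rewrite mpolyXE_id; apply: big_ind => [||i _]; first by rewrite -mpolyC1; apply: QC.
  by [].
by elim: (m i) => [|k IH]; rewrite ?expr0 -?mpolyC1 ?exprS; [apply: QC|apply: QM].
Qed.

Lemma dhomog_ind (n : nat) (R : nzRingType) (d : nat) (Q : {mpoly R[n]} -> Prop) :
  Q 0 -> (forall f g, Q f -> Q g -> Q (f + g)) ->
  (forall c m, mdeg m = d -> Q (c *: 'X_[m])) ->
  forall f, f \is d.-homog -> Q f.
Proof.
move=> Q0 QD QX f /dhomogP homf.
rewrite [f]mpolyE big_seq; apply: big_ind => // m /homf; exact: QX.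
Qed.

Lemma mmap_scale_homog (n d : nat) (R S : comNzRingType) (phi : {rmorphism R -> S})
    (h : 'I_n -> S) (t : S) (f : {mpoly R[n]}) :
  f \is d.-homog -> mmap phi (fun i => t * h i) f = t ^+ d * mmap phi h f.
Proof.
move=> homf; rewrite /mmap mulr_sumr big_seq [RHS]big_seq.
apply: eq_bigr => m /(dhomog_mf homf) /= dm.
rewrite mulrCA; congr (_ * _); rewrite -dm mdegE /mmap1 -prodrXr -big_split /=.
by apply: eq_bigr => i _; rewrite exprMn.
Qed.

(** The homogeneous components of [f * D] are those of [f] multiplied by
    [D]. *)
Lemma dhomog_cancel (n d e : nat) (R : idomainType) (f D : {mpoly R[n]}) :
  D != 0 -> D \is d.-homog -> f * D \is (e + d).-homog -> f \is e.-homog.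
Proof.
move=> nzD homD homfD.
have part g : pihomog mdeg (e + d) (g * D) = pihomog mdeg e g * D.
  pose k := (msize g + e).+1.
  have -> : g = \sum_(i < k) pihomog mdeg i g.
    apply: (pihomog_partitionE (mf := mdeg)).
    by rewrite -/(msize g) /k -addnS leq_addr.
  have ltek : (e < k)%N by rewrite ltnS leq_addl.
  rewrite mulr_suml !raddf_sum mulr_suml; apply: eq_bigr => i _ /=.
  have homi := pihomogP mdeg i g.
  have [->|ne] := eqVneq (i : nat) e.
    rewrite pihomog_id; apply: pihomog_dE.
    by apply: dhomogM => //; apply: pihomogP.
  rewrite (pihomog_ne0 ne) // mul0r; apply: pihomog_ne0 (dhomogM homi homD).
  by rewrite eqn_add2r.
have /(mulIf nzD) <- : pihomog mdeg e f * D = f * D.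
  by rewrite -part pihomog_dE.
exact: pihomogP.
Qed.

(** Polynomial expressions preserve congruences modulo [l]. *)
Lemma mmap_congr (n : nat) (R S : comNzRingType) (phi : {rmorphism R -> S})
    (h h' : 'I_n -> S) (l : S) (c : 'I_n -> S) (f : {mpoly R[n]}) :
  (forall i, h i = h' i + l * c i) ->
  exists g, mmap phi h f = mmap phi h' f + l * g.
Proof.
move=> hE; elim/mpoly_ring_ind: f => [a|i|f g [u fE] [v gE]|f g [u fE] [v gE]].
- by exists 0; rewrite !mmapC mulr0 addr0.
- by exists (c i); rewrite !mmapX !mmap1U.
- by exists (u + v); rewrite !mmapD fE gE; ring.
exists (mmap phi h' f * v + u * mmap phi h' g + l * u * v).
by rewrite !rmorphM /= fE gE; ring.
Qed.

Definition lform (R : nzRingType) (n : nat) (a : 'rV[R]_n) : {mpoly R[n]} :=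
  \sum_i a 0 i *: 'X_i.

Lemma lform_homog (R : nzRingType) (n : nat) (a : 'rV[R]_n) :
  lform a \is 1.-homog.
Proof.
by apply: rpred_sum => i _; apply: dhomogZ; rewrite dhomogX /= mdeg1.
Qed.

Lemma mmap_lform (R S : comNzRingType) (phi : {rmorphism R -> S}) (n : nat)
    (h : 'I_n -> S) (a : 'rV[R]_n) :
  mmap phi h (lform a) = \sum_i phi (a 0 i) * h i.
Proof. by rewrite raddf_sum; apply: eq_bigr => i _ /=; rewrite mmapZ mmapX mmap1U. Qed.

Lemma meval_lform (R : comNzRingType) (n : nat) (a v : 'rV[R]_n) :
  (lform a).@[v 0] = \sum_i a 0 i * v 0 i.
Proof. by rewrite raddf_sum; apply: eq_bigr => i _ /=; rewrite mevalZ mevalXU. Qed.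

Lemma lform_eq0 (R : nzRingType) (n : nat) (a : 'rV[R]_n) :
  (lform a == 0) = (a == 0).
Proof.
apply/eqP/eqP => [a0|->]; last by rewrite /lform big1 // => i _; rewrite mxE scale0r.
apply/rowP => i; move/mpolyP/(_ U_(i)%MM): a0.
rewrite raddf_sum /= (bigD1 i) //= big1 => [|j ne]; rewrite mcoeffZ mcoeffXU.
  by rewrite eqxx mulr1 addr0 mcoeff0 mxE.
by rewrite (negbTE ne) mulr0.
Qed.

(** * Counting the rational zeros of a form *)

Lemma rmorph_mmap (n : nat) (R S T : comNzRingType) (phi : {rmorphism R -> S})
    (psi : {rmorphism S -> T}) (h : 'I_n -> S) (k : 'I_n -> T) (f : {mpoly R[n]}) :
  (forall i, psi (h i) = k i) ->
  psi (mmap phi h f) = mmap (psi \o phi) k f.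
Proof.
move=> hk; rewrite /mmap rmorph_sum; apply: eq_bigr => m _.
rewrite rmorphM rmorph_prod; congr (_ * _); apply: eq_bigr => i _.
by rewrite rmorphXn /= hk.
Qed.

Lemma eq_mmap (n : nat) (R S : comNzRingType) (phi : R -> S) (h k : 'I_n -> S)
    (f : {mpoly R[n]}) :
  h =1 k -> mmap phi h f = mmap phi k f.
Proof. by move=> hk; apply: eq_bigr => m _; rewrite (mmap1_eq _ hk). Qed.

Definition line_poly (n : nat) (F : comNzRingType) (f : {mpoly F[n]})
    (w p : 'rV[F]_n) : {poly F} :=
  mmap polyC (fun j => (w 0 j)%:P + p 0 j *: 'X) f.

Lemma horner_line_poly (n : nat) (F : comNzRingType) (f : {mpoly F[n]})
    (w p : 'rV[F]_n) s :
  (line_poly f w p).[s] = f.@[(w + s *: p) 0].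
Proof.
rewrite /line_poly -horner_evalE.
rewrite (@rmorph_mmap _ _ _ _ _ _ _ ((w + s *: p) 0)) => [|i].
  by apply: eq_bigr => m _; rewrite /= horner_evalE hornerC.
by rewrite /= horner_evalE !hornerE !mxE mulrC.
Qed.

(** The behaviour of [f (w + s p)] at infinity is the behaviour of [f] near the
    projective point [p] on the line joining it to [w]: the coefficient in
    degree [d.+1] is the value at [p], and the next one is the linear form in
    [w] that defines the tangent line at [p]. *)
Section TangentExpansion.

Variables (n : nat) (F : comNzRingType) (p : 'rV[F]_n).

Definition tangent_expansion (d : nat) (f : {mpoly F[n]}) : Prop :=
  exists a : 'cV[F]_n, forall w,
    [/\ (size (line_poly f w p) <= d.+2)%N, (line_poly f w p)`_d.+1 = f.@[p 0]
      & (line_poly f w p)`_d = (w *m a) 0 0].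

Lemma tangent_expansionX i : tangent_expansion 0 'X_i.
Proof.
exists (delta_mx i 0) => w; rewrite /line_poly mmapX mmap1U mevalXU.
rewrite -colE mxE !coefD !coefC !coefZ !coefX /= mulr1 mulr0 addr0 add0r; split=> //.
apply/leq_sizeP => -[|[|j]] // _.
by rewrite coefD coefC coefZ coefX /= mulr0 addr0.
Qed.

Lemma tangent_expansionXM d i f :
  tangent_expansion d f -> tangent_expansion d.+1 ('X_i * f).
Proof.
move=> [a fE]; exists (f.@[p 0] *: delta_mx i 0 + p 0 i *: a) => w.
have [szf topf subf] := fE w.
have lineE j : (line_poly ('X_i * f) w p)`_j.+1 =
    w 0 i * (line_poly f w p)`_j.+1 + p 0 i * (line_poly f w p)`_j.
  rewrite /line_poly rmorphM /= mmapX mmap1U.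
  by rewrite mulrDl coefD coefCM -scalerAl coefZ coefXM.
split.
- apply/leq_sizeP => -[|j] // ltj; rewrite lineE !nth_default ?mulr0 ?addr0 //.
  + by apply: leq_trans szf _.
  + by apply: leq_trans szf _; apply: ltnW.
- by rewrite lineE topf nth_default ?mulr0 ?add0r // mevalM mevalXU.
rewrite lineE topf subf mulmxDr -!scalemxAr -colE !mxE.
by rewrite [w 0 i * _]mulrC.
Qed.

Lemma tangent_expansion_homog d f : f \is d.+1.-homog -> tangent_expansion d f.
Proof.
move: f; apply: dhomog_ind => [|f g [a fE] [b gE]|c m].
- exists 0 => w; rewrite /line_poly raddf0 size_poly0 !coef0 meval0 mulmx0 mxE.
  by split.
- exists (a + b) => w; have [szf topf subf] := fE w; have [szg topg subg] := gE w.
  rewrite /line_poly mmapD -!/(line_poly _ _ _) !coefD topf topg subf subg mevalD.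
  have -> : (w *m (a + b)) 0 0 = (w *m a) 0 0 + (w *m b) 0 0 by rewrite mulmxDr mxE.
  split=> //.
  by apply: leq_trans (size_polyD _ _) _; rewrite geq_max szf.
move=> dm; suff [a mE]: tangent_expansion d 'X_[m].
  exists (c *: a) => w; have [sz top sub] := mE w.
  rewrite /line_poly mmapZ -/(line_poly _ _ _) mevalZ !coefCM top sub.
  have -> : (w *m (c *: a)) 0 0 = c * (w *m a) 0 0 by rewrite -scalemxAr mxE.
  split=> //.
  rewrite mul_polyC; exact: leq_trans (size_scale_leq _ _) sz.
elim: d m dm => [|d IH] m dm.
  by have /mdeg1P[i /eqP->] := introT eqP dm; apply: tangent_expansionX.
have [i mi] : exists i, m i != 0%N.
  apply/existsP; apply: contraPT dm => /existsPn m0.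
  by rewrite mdegE big1 // => i _; apply/eqP; rewrite -[_ == _]negbK m0.
have mE : m = (U_(i) + (m - U_(i)))%MM by rewrite addmC submK // lep1mP.
rewrite mE mpolyXD; apply/tangent_expansionXM/IH.
by move: dm; rewrite {1}mE mdegD mdeg1 => -[].
Qed.

End TangentExpansion.

(** Complete [p], [w] to a basis, and let al, be, l be the dual coordinate
    forms.  Modulo l, the generic vector X is al p + be w, and by homogeneity
    [f (al p + be w)] is be^d times the value of [line_poly f w p] at al / be,
    which is zero.  So l divides [f]. *)
Lemma factor_through_line (d : nat) (F : fieldType) (f : {mpoly F[3]}) (w p : 'rV[F]_3) :
  f \is d.-homog -> p != 0 -> (forall s, w != s *: p) -> line_poly f w p = 0 ->
  exists a g, a != 0 /\ f = lform a * g.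
Proof.
move=> homf p0 wp line0.
pose U := col_mx p w.
(* V provides al and be; the projector E along the plane of p and w has rank
   one, so that E = A *m B, where A is the form l and B the third vector. *)
have freeU : row_free U.
  apply: inj_row_free => u.
  rewrite -[u]hsubmxK mul_row_col [lsubmx u]mx11_scalar [rsubmx u]mx11_scalar.
  rewrite !mul_scalar_mx.
  set a := lsubmx u 0 0; set b := rsubmx u 0 0 => E.
  have b0 : b = 0.
    apply/eqP; apply: contraT => nb; case/eqP: (wp (- (b^-1 * a))).
    move/eqP: E; rewrite addr_eq0 => /eqP E.
    by rewrite scaleNr -scalerA E scalerN opprK scalerA mulVf ?scale1r.
  have a0 : a = 0.
    by move/eqP: E; rewrite b0 scale0r addr0 scaler_eq0 (negPf p0) orbF => /eqP.
  by rewrite a0 b0 !raddf0 row_mx0.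
have [V UV] := row_freeP freeU.
pose E := 1%:M - V *m U.
have rankE : \rank E = 1%N.
  apply/eqP; rewrite eqn_leq; apply/andP; split.
    have UE : U *m E = 0 by rewrite mulmxBr mulmx1 mulmxA UV mul1mx subrr.
    by have := mulmx0_rank_max UE; rewrite (eqP freeU).
  rewrite lt0n mxrank_eq0; apply/negP => /eqP/subr0_eq E0.
  have := mxrankM_maxl V U; rewrite -E0 mxrank1.
  by move=> /leq_trans/(_ (rank_leq_col V)).
have [A [B EAB]] : exists (A : 'cV_3) (B : 'rV_3), E = A *m B.
  move: (col_base E) (row_base E) (mulmx_base E); rewrite rankE => A B <-.
  by exists A, B.
pose X : 'I_3 -> {mpoly F[3]} := fun i => 'X_i.
pose h j : {mpoly F[3]} := p 0 j *: lform (lsubmx V)^T + w 0 j *: lform (rsubmx V)^T.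
have XE i : 'X_i = h i + lform A^T * (B 0 i)%:MP.
  have /(congr1 (fun M : 'M_3 => \sum_k M k i *: ('X_k : {mpoly F[3]}))) :
      1%:M = V *m U + A *m B by rewrite -EAB addrC subrK.
  rewrite /h (bigD1 i) //= big1 => [|k ne]; last by rewrite mxE (negPf ne) scale0r.
  rewrite mxE eqxx scale1r addr0 => ->.
  rewrite mulrC mul_mpolyC /lform !scaler_sumr -!big_split; apply: eq_bigr => k _ /=.
  rewrite !scalerA -!scalerDl; congr (_ *: _).
  rewrite -{1}[V]hsubmxK mul_row_col !mxE !big_ord1 !mxE.
  ring.
have [g fE] :=
  @mmap_congr _ _ _ (@mpolyC 3 F) X h (lform A^T) (fun i => (B 0 i)%:MP) f XE.
exists A^T, g; split.
  apply: contra_eqN rankE => /eqP A0.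
  by rewrite EAB -[A]trmxK A0 trmx0 mul0mx mxrank0.
have fX : mmap (@mpolyC 3 F) X f = f.
  by rewrite [RHS]mpolyE; apply: eq_bigr => m _; rewrite mmap1_id mul_mpolyC.
rewrite -[LHS]fX fE; suff -> : mmap (@mpolyC 3 F) h f = 0 by rewrite add0r.
apply/eqP; rewrite -tofrac_eq0; apply/eqP.
pose al : {fraction {mpoly F[3]}} := tofrac (lform (lsubmx V)^T).
pose be : {fraction {mpoly F[3]}} := tofrac (lform (rsubmx V)^T).
have nzbe : be != 0.
  rewrite tofrac_eq0 lform_eq0; apply: contraTneq isT => V0.
  have /(congr1 (fun M : 'M_(1 + 1) => M (rshift 1 0) (rshift 1 0))) := UV.
  rewrite -[V]hsubmxK -[rsubmx V]trmxK V0 trmx0 mul_mx_row mulmx0 row_mxEr !mxE eqxx.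
  by move/esym/eqP; rewrite oner_eq0.
pose k j := be * (tofrac (w 0 j)%:MP + tofrac (p 0 j)%:MP * (al / be)).
rewrite (@rmorph_mmap _ _ _ _ _ _ _ k) => [|j]; last first.
  by rewrite /k /h rmorphD /= -!mul_mpolyC !rmorphM /= mulrDr mulrCA -/al -/be
             [be * (al / be)]mulrCA divff // mulr1 addrC [be * _]mulrC.
have homk := @mmap_scale_homog _ _ _ _ (@tofrac _ \o @mpolyC 3 F) _ be _ homf.
rewrite /k homk.
have := congr1 (fun P => (map_poly (@tofrac _ \o @mpolyC 3 F) P).[al / be]) line0.
rewrite rmorph0 horner0 /line_poly -horner_evalE.
pose k' j := tofrac (w 0 j)%:MP + tofrac (p 0 j)%:MP * (al / be).
pose psi : {rmorphism {poly F} -> {fraction {mpoly F[3]}}} :=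
  horner_eval (al / be) \o map_poly (@tofrac _ \o @mpolyC 3 F).
rewrite -[X in X = _]/(psi _).
rewrite (@rmorph_mmap _ _ _ _ _ psi _ k') => [|j].
  rewrite (_ : mmap (psi \o polyC) _ f = mmap (@tofrac _ \o @mpolyC 3 F) k' f).
    by move=> ->; rewrite mulr0.
  by apply: eq_bigr => m _; rewrite /= map_polyC horner_evalE hornerC.
by rewrite /k' /= horner_evalE rmorphD /= map_polyC map_polyZ map_polyX !hornerE.
Qed.

Lemma card_setId_sum (T : finType) (A : {set T}) (Q : pred T) :
  #|[set x in A | Q x]| = (\sum_(x in A) Q x)%N.
Proof.
rewrite -sum1_card (eq_bigl _ _ (in_set _)) /= big_mkcondr; apply: eq_bigr => x _.
by case: (Q x).
Qed.

Section Count.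

Variable F : finFieldType.
Local Notation q := #|F|.

Definition hyperplane (n : nat) (a : 'cV[F]_n) : {set 'rV[F]_n} :=
  [set w | (w *m a) 0 0 == 0].

(** The inequality also covers [a = 0]; it is the form needed for the tangent
    line, which is undetermined at a singular point. *)
Lemma card_hyperplane (n : nat) (a : 'cV[F]_n.+1) :
  (q ^ n <= #|hyperplane a|)%N /\ (a != 0 -> #|hyperplane a| = (q ^ n)%N).
Proof.
pose phi : 'Hom('rV[F]_n.+1, 'rV[F]_1) := linfun (mulmxr a).
have -> : #|hyperplane a| = (q ^ \dim (lker phi))%N.
  rewrite -card_vspace; apply: eq_card => w; rewrite inE memv_ker lfunE /=.
  apply/eqP/eqP => [w0|-> //]; last by rewrite mxE.
  by rewrite [w *m a]mx11_scalar w0 raddf0.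
have := limg_ker_dim phi fullv; rewrite capfv dimvf /dim /= mul1n => dimE.
have le1 : (\dim (limg phi) <= 1)%N by rewrite (leq_trans (dimvS (subvf _))) // dimvf.
have q1 : (1 < q)%N := finRing_gt1 F.
split=> [|nza]; first by rewrite leq_exp2l //; lia.
have ge1 : (0 < \dim (limg phi))%N.
  rewrite lt0n dimv_eq0; apply: contra nza => /eqP img0.
  apply/eqP/matrixP => i j; rewrite ord1 mxE.
  have : phi (delta_mx 0 i) \in limg phi by rewrite memv_img ?memvf.
  rewrite img0 memv0 lfunE /= -rowE => /eqP/matrixP/(_ 0 0).
  by rewrite !mxE.
by congr (q ^ _)%N; lia.
Qed.

Definition zeros (f : {mpoly F[3]}) : {set 'rV[F]_3} :=
  [set v : 'rV[F]_3 | (v != 0) && (f.@[v 0] == 0)].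

(** Fix a zero [p].  For a vector [w] off the line of [p], the polynomial
    [f (w + s p)] has degree at most [d] in [s], and at most [d - 1] when [w] is
    on the tangent [H] at [p]; if it is zero then [f] has a linear factor.
    Summing the numbers of roots over all [w] counts each zero off the line of
    [p] exactly [q] times. *)
Lemma linear_factor_or_few_zeros (d : nat) (f : {mpoly F[3]}) :
  f \is d.+1.-homog ->
  (exists a g, a != 0 /\ f = lform a * g) \/ (#|zeros f| <= d * (q ^ 2 - 1))%N.
Proof.
move=> homf.
have q1 : (1 < q)%N := finRing_gt1 F.
have [->|[p]] := set_0Vmem (zeros f); first by rewrite cards0; right.
rewrite inE => /andP[p0 /eqP fp0].
pose line := [set s *: p | s : F].
have [/existsP[w /andP[wline /eqP line0]]|/existsPn noline] :=
    boolP [exists w, (w \notin line) && (line_poly f w p == 0)].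
  left; apply: (factor_through_line homf p0 _ line0) => s.
  by apply: contra wline => /eqP ->; apply: imset_f.
right.
have cardline : #|line| = q.
  rewrite card_imset // => s t /eqP; rewrite -subr_eq0 -scalerBl scaler_eq0.
  by rewrite (negPf p0) orbF subr_eq0 => /eqP.
have cardN : #|~: line| = (q ^ 3 - q)%N.
  by rewrite cardsCs setCK cardline card_mx mul1n.
have [a aE] := tangent_expansion_homog p homf.
pose H := hyperplane a.
have cardNH : (q ^ 2 - q <= #|~: line :&: H|)%N.
  rewrite setIC -setDE cardsD.
  have [leH _] := card_hyperplane a.
  have := subset_leq_card (subsetIr H line); rewrite cardline => leHl.
  exact: leq_sub.
have onN : (#|zeros f :&: ~: line| * q + #|~: line :&: H| <= d * #|~: line|)%N.
  pose R w := [set s : F | (line_poly f w p).[s] == 0].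
  have roots w : w \in ~: line -> (#|R w| + (w \in H) <= d)%N.
    rewrite inE => wN.
    have nz : line_poly f w p != 0. by have := noline w; rewrite wN.
    have [sz top sub] := aE w.
    have : (#|R w| < size (line_poly f w p))%N.
      rewrite cardE; apply: max_poly_roots nz _ (enum_uniq _).
      by apply/allP => s; rewrite mem_enum inE.
    have : (size (line_poly f w p) + (w \in H) <= d.+1)%N; last lia.
    have sz1 : (size (line_poly f w p) <= d.+1)%N.
      apply/leq_sizeP => j; rewrite leq_eqVlt => /predU1P[<-|ltj].
        by rewrite top fp0.
      by rewrite nth_default // (leq_trans sz).
    have [|_] := boolP (w \in H); last by rewrite addn0.
    rewrite inE -sub => /eqP sub0; rewrite addn1 ltnS.
    apply/leq_sizeP => j; rewrite leq_eqVlt => /predU1P[<- //|ltj].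
    by rewrite nth_default // (leq_trans sz1).
  have -> : (#|zeros f :&: ~: line| * q = \sum_(w in ~: line) #|R w|)%N.
    transitivity (\sum_(s : F) #|[set w in ~: line | s \in R w]|)%N.
      rewrite mulnC -sum_nat_const; apply: eq_bigr => s _.
      rewrite -(card_imset _ (addIr (- (s *: p)))); apply: eq_card => w.
      have NE (v : 'rV_3) t : (v + t *: p \in line) = (v \in line).
        apply/imsetP/imsetP => [[r _ E]|[r _ ->]].
          by exists (r - t); rewrite // scalerBl -E addrK.
        by exists (r + t); rewrite // scalerDl.
      apply/imsetP/setIdP => [[v]|[wN wR]].
        rewrite !inE => /andP[/andP[_ fv] vN] ->.
        by rewrite -scaleNr NE vN horner_line_poly scaleNr subrK.
      exists (w + s *: p); last by rewrite addrK.
      move: wR (wN); rewrite !inE NE horner_line_poly => -> ->; rewrite !andbT.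
      rewrite inE in wN.
      apply: contraNneq wN => w0; apply/imsetP; exists (- s) => //.
      by apply/eqP; rewrite scaleNr -addr_eq0 w0.
    rewrite (eq_bigr (fun s => \sum_(w in ~: line) (s \in R w))%N) => [|s _];
      last exact: card_setId_sum.
    rewrite exchange_big; apply: eq_bigr => w _.
    rewrite -sum1_card [RHS]big_mkcond; apply: eq_bigr => s _ /=.
    by case: (s \in R w).
  have -> : (#|~: line :&: H| = \sum_(w in ~: line) (w \in H))%N.
    by rewrite -card_setId_sum; apply: eq_card => w; rewrite !inE.
  rewrite -big_split mulnC -sum_nat_const; exact: leq_sum.
have online : (#|zeros f :&: line| <= q - 1)%N.
  have sub : zeros f :&: line \subset line :\ 0.
    by apply/subsetP => w; rewrite !inE => /andP[/andP[-> _]].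
  apply: leq_trans (subset_leq_card sub) _; rewrite -cardline (cardsD1 0 line).
  have -> : 0 \in line by apply/imsetP; exists 0; rewrite ?scale0r.
  by rewrite add1n subn1.
have := cardsID line (zeros f); rewrite setDE => <-.
move: onN online cardNH q1; rewrite cardN.
move: #|_ :&: line| #|_ :&: ~: line| #|_ :&: H| #|F| => x y h r.
move=> onN online cardNH r1; rewrite -(leq_pmul2r (ltnW r1)) mulnDl.
have -> : (d * (r ^ 2 - 1) * r = d * (r ^ 3 - r))%N.
  by rewrite -mulnA mulnBl mul1n -expnSr.
apply: leq_trans onN; rewrite addnC leq_add2l; apply: leq_trans cardNH.
have -> : (r ^ 2 - r = (r - 1) * r)%N by rewrite mulnBl mul1n mulnn.
by rewrite leq_mul2r online orbT.
Qed.

End Count.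

(** * The coordinates of the plane *)

Lemma homogX (R : nzRingType) (n : nat) (k : 'I_n) :
  ('X_k : {mpoly R[n]}) \is 1.-homog.
Proof. by rewrite dhomogX /= mdeg1. Qed.

Lemma mpolyX_neq0 (R : nzRingType) (n : nat) (k : 'I_n) :
  'X_k != 0 :> {mpoly R[n]}.
Proof. by rewrite -msupp_eq0 msuppX. Qed.

Definition i0 : 'I_3 := ord0.
Definition i1 : 'I_3 := lift ord0 ord0.
Definition i2 : 'I_3 := ord_max.

Lemma sum3E (V : nmodType) (f : 'I_3 -> V) : \sum_i f i = f i0 + f i1 + f i2.
Proof.
rewrite !big_ord_recl big_ord0 addr0 addrA; congr (_ + f _); exact: val_inj.
Qed.

(** * Divisibility by a form free of the last variable *)

Section Divisibility.

Variables (n : nat) (R : idomainType).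

Lemma muni_widen (i : 'I_n) :
  muni ('X_(widen_ord (leqnSn n) i) : {mpoly R[n.+1]}) = ('X_i)%:P.
Proof.
rewrite muniE msuppX big_seq1 mcoeffX eqxx scale1r mnm1E.
rewrite (_ : _ == _ = false); last first.
  by apply/eqP => /(congr1 val) /= E; have := ltn_ord i; rewrite E ltnn.
rewrite expr0 alg_polyC; congr ('X_[_])%:P; apply/mnmP => j.
by rewrite !mnmE.
Qed.

Lemma muni_last : muni ('X_ord_max : {mpoly R[n.+1]}) = 'X.
Proof.
rewrite muniE msuppX big_seq1 mcoeffX eqxx scale1r mnm1E eqxx expr1.
rewrite (_ : [multinom _ | _ < _] = 0%MM) ?mpolyX0 ?scale1r //.
apply/mnmP => j; rewrite !mnmE; apply/eqP; rewrite eqb0.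
by apply/eqP => /(congr1 val) /= E; have := ltn_ord j; rewrite -E ltnn.
Qed.

Definition of_muni (p : {poly {mpoly R[n]}}) : {mpoly R[n.+1]} :=
  (map_poly (@mwiden n R) p).['X_ord_max].

Lemma of_muniM p r : of_muni (p * r) = of_muni p * of_muni r.
Proof. by rewrite /of_muni rmorphM hornerM. Qed.

Lemma of_muniD p r : of_muni (p + r) = of_muni p + of_muni r.
Proof. by rewrite /of_muni rmorphD hornerD. Qed.

Lemma muniK : cancel (@muni n R) of_muni.
Proof.
move=> p; elim/mpoly_ring_ind: p => [c|i|f g fE gE|f g fE gE].
- by rewrite muniC /of_muni map_polyC hornerC /= mwidenC.
- have [[j ->]|->] : (exists j, i = widen_ord (leqnSn n) j) \/ i = ord_max.
    case: (unliftP ord_max i) => [j ->|->]; last by right.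
    by left; exists j; apply: val_inj; exact: lift_max.
  + by rewrite muni_widen /of_muni map_polyC hornerC /= mwidenX mnmwiden1.
  by rewrite muni_last /of_muni map_polyX hornerX.
- by rewrite muniD of_muniD; congr (_ + _).
by rewrite muniM of_muniM; congr (_ * _).
Qed.

(** Seen as polynomials in the last variable, [D] is a constant and [D'] is
    monic.  Divide [A'] by [D'] with remainder; multiplying by [D] and using
    uniqueness of division by a monic polynomial, the quotient times [D] is
    [A]. *)
Lemma dvd_coprime_monic (D D' A A' : {mpoly R[n.+1]}) (c : {mpoly R[n]}) :
  muni D = c%:P -> muni D' \is monic -> A * D' = A' * D -> exists f, A = f * D.
Proof.
move=> DE monD' /(congr1 (@muni n R)); rewrite !muniM DE => E.
pose Q := Pdiv.Ring.rdivp (muni A') (muni D').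
pose T := Pdiv.Ring.rmodp (muni A') (muni D').
have AE : muni A' = Q * muni D' + T := Pdiv.RingMonic.rdivp_eq monD' _.
have szT : (size T < size (muni D'))%N by apply: Pdiv.Ring.ltn_rmodpN0; apply: monic_neq0.
exists (of_muni Q); rewrite -[LHS]muniK -[D]muniK -of_muniM; congr of_muni; rewrite DE.
apply/eqP; rewrite -subr_eq0; apply/negP => /negP nz.
have : (muni A - Q * c%:P) * muni D' = T * c%:P by rewrite mulrBl E AE; ring.
move=> /(congr1 (fun p => size (p : {poly _}))); rewrite size_Mmonic // => szE.
have : ((size (muni A - Q * c%:P)%R + size (muni D')).-1 <= size T)%N.
  by rewrite szE mulrC mul_polyC size_scale_leq.
rewrite -size_poly_gt0 in nz; rewrite -(prednK nz) addSn /= => le.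
by move: szT; rewrite ltnNge (leq_trans (leq_addl _ _) le).
Qed.

End Divisibility.
(** * Curves through the point *)

Lemma monic_quadratic (R : nzRingType) (c a b a' b' d : R) :
  'X^2 - c%:P * (a *: b%:P + a' *: b'%:P + d *: 'X) \is monic.
Proof.
rewrite monicE lead_coefDl ?lead_coefXn // size_polyXn size_polyN ltnS.
apply/leq_sizeP => -[|[|j]] // _.
by rewrite coefCM !coefD !coefZ !coefC coefX /= !mulr0 !addr0 mulr0.
Qed.

Section LinearForms.

Variables (F : fieldType) (L : fieldExtType F) (P : 'I_3 -> L).

Lemma eval_at_lform (a : 'rV[F]_3) : eval_at P (lform a) = \sum_i a 0 i *: P i.
Proof. by rewrite /eval_at mmap_lform; apply: eq_bigr => i _; rewrite /= mulr_algl. Qed.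

Lemma eval_atM f g : eval_at P (f * g) = eval_at P f * eval_at P g.
Proof. by rewrite /eval_at rmorphM. Qed.

Lemma eval_atB f g : eval_at P (f - g) = eval_at P f - eval_at P g.
Proof. by rewrite /eval_at raddfB. Qed.

Lemma eval_atX i : eval_at P 'X_i = P i.
Proof. by rewrite /eval_at mmapX mmap1U. Qed.

Hypothesis dimL : \dim {:L} = 3%N.
Hypothesis hline : not_on_a_line P.

Lemma linear_form_neq0 l : l \is 1.-homog -> l != 0 -> eval_at P l != 0.
Proof. by move=> homl nzl; apply/eqP => l0; apply: (hline nzl). Qed.

Lemma coord_neq0 i : P i != 0.
Proof.
by rewrite -eval_atX linear_form_neq0 ?homogX ?mpolyX_neq0.
Qed.

(** Three linearly independent coordinates in a space of dimension 3. *)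
Lemma linear_form_onto y : exists a, eval_at P (lform a) = y.
Proof.
pose X := [tuple P i | i < 3].
have XE (k : 'I_3 -> F) : \sum_(i < 3) k i *: X`_i = eval_at P (lform (\row_i k i)).
  rewrite eval_at_lform; apply: eq_bigr => i _.
  by rewrite mxE -tnth_nth tnth_mktuple.
have basisX : basis_of fullv X.
  rewrite basisEfree subvf dimL size_tuple !andbT; apply/freeP => k.
  rewrite XE => k0 i; apply/eqP; apply: contraTT isT => nz.
  have nzl : lform (\row_i k i) != 0.
    by rewrite lform_eq0; apply: contra nz => /eqP/rowP/(_ i); rewrite !mxE => ->.
  by have := linear_form_neq0 (lform_homog _) nzl; rewrite k0 eqxx.
by exists (\row_i coord X i y); rewrite -XE -(coord_basis basisX) ?memvf.
Qed.

(** [a] is the linear form whose value at P is [l(P)^2 / l0(P)]. *)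
Lemma conic_through l l0 :
  l \is 1.-homog -> l0 \is 1.-homog -> l0 != 0 ->
  exists a, form_through P 2 (l ^+ 2 - l0 * lform a) /\
    eval_at P (lform a) = eval_at P l ^+ 2 / eval_at P l0.
Proof.
move=> homl homl0 nzl0.
have [a aE] := linear_form_onto (eval_at P l ^+ 2 / eval_at P l0).
exists a; split=> //; split.
  apply: rpredB; first exact: (dhomogM homl homl).
  exact: (dhomogM homl0 (lform_homog a)).
rewrite eval_atB expr2 !eval_atM aE mulrCA divff ?linear_form_neq0 //.
by rewrite mulr1 expr2 subrr.
Qed.

(** Take [l] a coordinate that is nonzero at [v], and [l0] a linear form
    vanishing at [v]: the conic [l ^+ 2 - l0 * m] takes the value [l(v)^2]. *)
Lemma conic_avoiding (v : 'I_3 -> F) i : v i != 0 ->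
  exists g, form_through P 2 g /\ g.@[v] != 0.
Proof.
move=> vi; have [j ji] : exists j : 'I_3, j != i.
  by case: (eqVneq i i0) => [->|ne]; [exists i1|exists i0; rewrite eq_sym].
pose l0 : {mpoly F[3]} := v i *: 'X_j - v j *: 'X_i.
have homX := @homogX F 3.
have nzl0 : l0 != 0.
  apply: contra vi => /eqP/mpolyP/(_ U_(j)%MM).
  rewrite mcoeffB !mcoeffZ !mcoeffXU eqxx eq_sym (negPf ji).
  by rewrite mulr0 subr0 mulr1 mcoeff0 => ->.
have homl0 : l0 \is 1.-homog by rewrite rpredB ?dhomogZ.
have [a [through _]] := conic_through (homX i) homl0 nzl0.
exists ('X_i ^+ 2 - l0 * lform a); split=> //.
rewrite mevalB rmorphXn /= mevalM mevalXU.
rewrite /l0 mevalB !mevalZ !mevalXU [v j * _]mulrC subrr mul0r subr0.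
by rewrite expf_neq0.
Qed.

Lemma annihilating_poly (x : L) :
  exists2 p : {poly F}, p != 0 & root (map_poly (in_alg L) p) x.
Proof.
have /polyOver1P[p pE] := minPolyOver 1%AS x.
exists p; last by rewrite -pE root_minPoly.
by rewrite -(map_poly_eq0 (in_alg L)) -pE monic_neq0 ?monic_minPoly.
Qed.

(** The homogenized annihilating polynomial of [P i1 / P i0] involves only the
    first two variables, and it vanishes at P. *)
Lemma binary_form_through :
  exists e h, [/\ form_through P e h, h != 0 & exists c, muni h = c%:P].
Proof.
have [p nzp rootp] := annihilating_poly (P i1 / P i0).
pose e := (size p).-1.
pose h : {mpoly F[3]} := \sum_(i < size p) p`_i *: ('X_i1 ^+ i * 'X_i0 ^+ (e - i)).
have homX := @homogX F 3.
have le (i : 'I_(size p)) : (i <= e)%N by rewrite -ltnS prednK ?size_poly_gt0.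
exists e, h; split; first split.
- apply: rpred_sum => i _; apply: dhomogZ.
  have := dhomogM (dhomogMn i (homX i1)) (dhomogMn (e - i) (homX i0)).
  by rewrite !mul1n subnKC.
- transitivity (P i0 ^+ e * (map_poly (in_alg L) p).[P i1 / P i0]); last first.
    by rewrite (rootP rootp) mulr0.
  rewrite horner_coef size_map_poly mulr_sumr /eval_at raddf_sum.
  apply: eq_bigr => i _; rewrite /= mmapZ rmorphM !rmorphXn /= !mmapX !mmap1U coef_map.
  rewrite -{2}(subnKC (le i)) exprD exprMn exprVn /=.
  have nz : P i0 ^+ i != 0 by rewrite expf_neq0 ?coord_neq0.
  by field.
- pose k (i : 'I_3) : {poly F} := if i == i1 then 'X else 1.
  apply: contra nzp => /eqP h0; apply/eqP.
  have := congr1 (mmap polyC k) h0; rewrite raddf0 => <-.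
  rewrite -[LHS]coefK poly_def raddf_sum.
  apply: eq_bigr => i _; rewrite /= mmapZ rmorphM !rmorphXn /= !mmapX !mmap1U /k eqxx.
  by rewrite expr1n mulr1 mul_polyC.
exists (\sum_(i < size p) (p`_i)%:MP * ('X_(lift ord0 ord0) ^+ i * 'X_ord0 ^+ (e - i))).
rewrite raddf_sum rmorph_sum /=; apply: eq_bigr => i _.
rewrite muniZ -mul_polyC [in RHS]polyCM; congr (_ * _).
rewrite !rmorphM !rmorphXn /=.
have -> : i0 = widen_ord (leqnSn 2) ord0 by apply: val_inj.
have -> : i1 = widen_ord (leqnSn 2) (lift ord0 ord0) by apply: val_inj.
by rewrite !muni_widen.
Qed.

(** Together with the binary form of [binary_form_through], this gives two
    denominators of the affine cover to which [dvd_coprime_monic] applies. *)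
Lemma monic_conic_through :
  exists g, form_through P 2 g /\ muni ('X_i2 * g) \is monic.
Proof.
have homX := @homogX F 3.
have nzX := @mpolyX_neq0 F 3 i0.
have [a [through _]] := conic_through (homX i2) (homX i0) nzX.
exists ('X_i2 ^+ 2 - 'X_i0 * lform a); split=> //.
have E0 : i0 = widen_ord (leqnSn 2) ord0 by apply: val_inj.
have E1 : i1 = widen_ord (leqnSn 2) (lift ord0 ord0) by apply: val_inj.
rewrite /lform sum3E muniM muniB rmorphXn /= muniM !muniD !muniZ.
rewrite E0 E1 !muni_widen muni_last.
rewrite monicMr ?monicX //.
exact: monic_quadratic.
Qed.

(** If the last coefficient of [m] were zero, [P i1 / P i0] would be quadratic
    over F, hence in F as L has degree 3, and P would lie on a line.  The
    coefficient being nonzero has two uses: the conic is transverse at P to the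
    direction of the last coordinate, and [m] can replace the last coordinate,
    in which the conic becomes a parabola. *)
Lemma parabola_through :
  exists m, form_through P 2 ('X_i1 ^+ 2 - 'X_i0 * lform m) /\ m 0 i2 != 0.
Proof.
have homX := @homogX F 3.
have nzX := @mpolyX_neq0 F 3 i0.
have [m [through mE]] := conic_through (homX i1) (homX i0) nzX.
exists m; split=> //; apply/eqP => m20.
pose th := P i1 / P i0.
have P0 := coord_neq0 i0.
have thE : th ^+ 2 = (m 0 i0)%:A + m 0 i1 *: th.
  move: mE; rewrite eval_at_lform sum3E m20 scale0r addr0 !eval_atX => mE.
  have -> : th ^+ 2 = P i1 ^+ 2 / P i0 / P i0 by rewrite /th; field.
  by rewrite -mE mulrDl -!scalerAl divff.
have : th \in 1%VS.
  rewrite -adjoin_deg_eq1.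
  have divs : (adjoin_degree 1%AS th %| 3)%N.
    have := field_dimS (subvf <<1; th>>%AS).
    by rewrite dimL dim_Fadjoin dimv1 muln1.
  have small : (adjoin_degree 1%AS th <= 2)%N.
    rewrite leqNgt; apply/negP => big.
    pose r : {poly L} := ((m 0 i1)%:A)%:P * 'X + ((m 0 i0)%:A)%:P.
    have szr : (size r < 3)%N.
      rewrite /r size_MXaddC; case: ifP => // _; rewrite ltnS size_polyC.
      by case: (_ != _).
    have szp : size ('X^2 - r) = 3%N by rewrite size_polyDl size_polyXn // size_polyN.
    have overp : 'X^2 - r \is a polyOver 1%AS.
      rewrite rpredB ?rpredX ?polyOverX // rpredD ?rpredM ?polyOverC ?polyOverX //;
        exact: rpredZ (mem1v _).
    have := root_small_adjoin_poly overp; rewrite szp => /(_ th big).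
    rewrite -size_poly_eq0 szp /root /r !hornerE /= thE mulr_algl.
    by rewrite -scalerAl -/th [X in X - _]addrC subrr eqxx.
  by move: small divs; case: (adjoin_degree _ _) => [|[|[|]]].
case/vlineP => k thk.
pose l : {mpoly F[3]} := 'X_i1 - k *: 'X_i0.
have homl : l \is 1.-homog by rewrite rpredB ?dhomogZ.
have nzl : l != 0.
  apply: contraTneq isT => /(congr1 (fun f : {mpoly F[3]} => f@_U_(i1))).
  rewrite mcoeffB mcoeffZ !mcoeffXU eqxx mulr0 subr0 mcoeff0.
  by move/eqP; rewrite oner_eq0.
have := linear_form_neq0 homl nzl; apply/negP; rewrite negbK.
rewrite /l eval_atB -mul_mpolyC eval_atM !eval_atX /eval_at mmapC /= -thk /th.
by rewrite mulfVK ?subrr.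
Qed.

End LinearForms.

(** * Points and sections of the blow-up *)

Section BlowUp.

Variables (F : fieldType) (L : fieldExtType F) (P : 'I_3 -> L).
Hypothesis dimL : \dim {:L} = 3%N.
Hypothesis hline : not_on_a_line P.

Lemma ideal_pow0 f : ideal_pow P 0 f.
Proof.
exists 1%N, (fun=> f), (fun _ _ => 0); split; first by move=> ? [].
by rewrite big_ord1 big_ord0 mulr1.
Qed.

Lemma ideal_powX d g k : form_through P d g -> ideal_pow P k (g ^+ k).
Proof.
move=> hg; exists 1%N, (fun=> 1), (fun _ _ => g); split; first by exists d.
by rewrite big_ord1 prodr_const card_ord mul1r.
Qed.

Lemma ideal_pow1 d g : form_through P d g -> ideal_pow P 1 g.
Proof. exact: (@ideal_powX d g 1). Qed.

(** Let [g] be a conic through P with [g(v) <> 0], where [v] is the image in the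
    plane.  Evaluating [f * g ^+ k] in two ways, with [f] in I^k and [g ^+ k] in
    I^0 or conversely, gives [ev k f * g(v)^k = f(v) * ev 1 g ^+ k].  Geometrically,
    no rational point lies on the exceptional divisor. *)
Lemma rational_point_eval ev : rational_point P ev ->
  exists2 kappa : F, kappa != 0 &
    forall k f, ideal_pow P k f -> ev k f = f.@[fun i => ev 0%N 'X_i] * kappa ^+ k.
Proof.
move=> [evC evD evM [i vi] [d [g0 [through0 ev0]]]].
set v := fun i => ev 0%N 'X_i.
have ev0E f : ev 0%N f = f.@[v].
  elim/mpoly_ring_ind: f => [c|j|f g fE gE|f g fE gE].
  - by rewrite evC mevalC.
  - by rewrite mevalXU.
  - by rewrite evD ?mevalD ?fE ?gE //; apply: ideal_pow0.
  by rewrite (evM 0%N 0%N) ?mevalM ?fE ?gE //; apply: ideal_pow0.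
have [g [through gv]] := conic_avoiding dimL hline (v := v) vi.
have evX k : ev k (g ^+ k) = ev 1%N g ^+ k.
  elim: k => [|k IH]; first by rewrite !expr0 ev0E meval1.
  rewrite !exprS -IH -add1n; apply: evM; first exact: ideal_pow1 through.
  exact: ideal_powX through.
have evE k f : ideal_pow P k f -> ev k f = f.@[v] * (ev 1%N g / g.@[v]) ^+ k.
  move=> fk; apply: (mulIf (expf_neq0 k gv)).
  rewrite -mulrA -exprMn divfK // -evX -rmorphXn /= -!ev0E.
  have := evM k 0%N f (g ^+ k) fk (ideal_pow0 _); rewrite addn0 => <-.
  by have := evM 0%N k f (g ^+ k) (ideal_pow0 f) (ideal_powX k through); rewrite add0n.
exists (ev 1%N g / g.@[v]) => //.
apply: contraNneq ev0 => k0.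
by rewrite (evE _ _ (ideal_pow1 through0)) k0 expr1 mulr0.
Qed.

Lemma rational_point_meval (v : 'I_3 -> F) i :
  v i != 0 -> rational_point P (fun _ f => f.@[v]).
Proof.
move=> vi; split=> [c|k f g _ _|k l f g _ _||].
- exact: mevalC.
- exact: mevalD.
- exact: mevalM.
- by exists i; rewrite mevalXU.
by have [g [through gv]] := conic_avoiding dimL hline vi; exists 2%N, g.
Qed.

Lemma same_pointP ev ev' : rational_point P ev -> rational_point P ev' ->
  same_point P ev ev' <->
  exists2 la : F, la != 0 & forall i, ev' 0%N 'X_i = la * ev 0%N 'X_i.
Proof.
move=> hev hev'; split=> [[la [mu [nzla nzmu E]]]|[la nzla E]].
  exists la => // i; rewrite (E 1%N) ?expr1 ?expr0 ?mulr1 //.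
  by split; [exact: homogX|apply: ideal_pow0].
have [ka nzka evE] := rational_point_eval hev.
have [ka' nzka' evE'] := rational_point_eval hev'.
exists la, (ka' / ka); split=> //; first by rewrite mulf_neq0 ?invr_neq0.
move=> a k f [homf fk]; rewrite evE // evE'//.
rewrite [f.@[fun i => ev' _ _]](_ : _ = la ^+ a * f.@[fun i => ev 0%N 'X_i]).
  rewrite exprMn exprVn; have nz : ka ^+ k != 0 by rewrite expf_neq0.
  by field.
rewrite /meval -mmap_scale_homog //; exact: eq_mmap.
Qed.

(** The restriction of a form to the line through P in the direction of the last
    coordinate.  The variable is a local parameter of this line at P, so the
    forms of I^k vanish to order at least k at 0. *)
Definition vertical_line : {mpoly F[3]} -> {poly L} :=
  mmap (polyC \o in_alg L) (fun j => (P j)%:P + (j == i2)%:R *: 'X).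

Lemma vertical_lineM f g : vertical_line (f * g) = vertical_line f * vertical_line g.
Proof. exact: rmorphM. Qed.

Lemma vertical_lineD f g : vertical_line (f + g) = vertical_line f + vertical_line g.
Proof. exact: rmorphD. Qed.

Lemma vertical_line0 f : (vertical_line f).[0] = eval_at P f.
Proof.
rewrite /vertical_line -horner_evalE (@rmorph_mmap _ _ _ _ _ _ _ P) => [|i].
  by apply: eq_bigr => m _; rewrite /= horner_evalE hornerC.
by rewrite /= horner_evalE !hornerE.
Qed.

Lemma vertical_lineX i : vertical_line 'X_i = (P i)%:P + (i == i2)%:R *: 'X.
Proof. by rewrite /vertical_line mmapX mmap1U. Qed.

Lemma vertical_line_lform m :
  vertical_line (lform m) = (eval_at P (lform m))%:P + ((m 0 i2)%:A)%:P * 'X.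
Proof.
rewrite /vertical_line mmap_lform eval_at_lform raddf_sum (bigD1 i2) //=.
rewrite [in RHS](bigD1 i2) //= ?eqxx scale1r mulrDr -polyCM mulr_algl -!addrA.
congr (_ + _); rewrite addrC; congr (_ + _); apply: eq_bigr => i /negPf ->.
by rewrite scale0r addr0 -polyCM mulr_algl.
Qed.

Lemma vertical_line_ideal_pow k f :
  ideal_pow P k f -> exists u, vertical_line f = 'X^k * u.
Proof.
case=> r [c [g [through ->]]].
have dvdg i j : exists u, vertical_line (g i j) = 'X * u.
  have [d [_ g0]] := through i j.
  have /factor_theorem[u ->] : root (vertical_line (g i j)) 0.
    by rewrite /root vertical_line0 g0.
  by exists u; rewrite subr0 mulrC.
elim/big_ind: _ => [|x y [u xE] [w yE]|i _].
- by exists 0; rewrite /vertical_line raddf0 mulr0.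
- by exists (u + w); rewrite vertical_lineD xE yE mulrDr.
have prodE l (h : 'I_l -> {mpoly F[3]}) :
    (forall j, exists u, vertical_line (h j) = 'X * u) ->
    exists u, vertical_line (\prod_(j < l) h j) = 'X^l * u.
  elim: l h => [|l IH] h dvdh.
    by exists 1; rewrite big_ord0 mulr1 /vertical_line rmorph1.
  rewrite big_ord_recl vertical_lineM; have [a ->] := dvdh ord0.
  have [b ->] := IH _ (fun j => dvdh (lift ord0 j)).
  by exists (a * b); rewrite exprS; ring.
have [u uE] := prodE k (g i) (dvdg i).
by exists (vertical_line (c i) * u); rewrite vertical_lineM uE mulrCA.
Qed.

Lemma cubic_section f : form_through P 3 f -> global_section P 3 1 (tofrac f).
Proof.
move=> [homf f0] i b g _ _; exists 0%N, f.
rewrite mul0n addn0 addn0 expr0 tofrac1 divr1; split=> //; split=> //.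
by apply: (@ideal_pow1 3); split.
Qed.

Lemma section_denominator (s : {fraction {mpoly F[3]}}) i b g :
  global_section P 3 1 s -> form_through P b g -> g != 0 ->
  exists N A, [/\ A \is (3 + N * b.+1).-homog, ideal_pow P (1 + N) A
    & s * tofrac (('X_i * g) ^+ N) = tofrac A].
Proof.
move=> hs through nzg; have [N [A [[homA hA] ->]]] := hs i b g through nzg.
exists N, A; split=> //.
by rewrite divfK // tofrac_eq0 expf_neq0 // mulf_neq0 ?mpolyX_neq0.
Qed.

(** Use the denominators [x_0 h] with [h] binary, and [x_2 g] with [x_2 g] monic
    in [x_2]. *)
Lemma section_polynomial (s : {fraction {mpoly F[3]}}) :
  global_section P 3 1 s -> exists2 f, f \is 3.-homog & s = tofrac f.
Proof.
move=> hs.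
have [e [h [through nzh [c hE]]]] := binary_form_through hline.
have [g [through' mong]] := monic_conic_through dimL hline.
have nzg : g != 0.
  by apply: contraTneq mong => ->; rewrite mulr0 muni0 monicE lead_coef0 eq_sym oner_eq0.
have [N [A [homA _ sA]]] := section_denominator i0 hs through nzh.
have [N' [A' [_ _ sA']]] := section_denominator i2 hs through' nzg.
pose D := ('X_i0 * h) ^+ N; pose D' := ('X_i2 * g) ^+ N'.
have DE : muni D = (('X_ord0 * c) ^+ N)%:P.
  rewrite /D rmorphXn /= muniM hE.
  have -> : i0 = widen_ord (leqnSn 2) ord0 by apply: val_inj.
  by rewrite muni_widen -polyCM polyC_exp.
have monD' : muni D' \is monic by rewrite /D' rmorphXn monic_exp.
have AD : A * D' = A' * D.
  by apply/eqP; rewrite -tofrac_eq !tofracM -sA -sA' mulrAC.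
have [f fE] := dvd_coprime_monic DE monD' AD.
have nzD : D != 0 by rewrite expf_neq0 // mulf_neq0 ?mpolyX_neq0.
exists f.
  apply: (@dhomog_cancel _ (N * e.+1) _ _ _ D) => //; last by rewrite -fE.
  by rewrite mulnC; apply: dhomogMn; apply: dhomogM (homogX _ _) through.1.
apply: (@mulIf _ (tofrac D)); first by rewrite tofrac_eq0.
by rewrite sA fE tofracM.
Qed.

(** Take the denominator [x_0 g] with [g] the conic of [parabola_through].  The
    numerator [f (x_0 g)^N] lies in I^(N+1), so it vanishes to order [N + 1] on
    the vertical line, whereas [(x_0 g)^N] vanishes there to order exactly
    [N]. *)
Lemma section_cubic (s : {fraction {mpoly F[3]}}) :
  global_section P 3 1 s -> exists2 f, form_through P 3 f & s = tofrac f.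
Proof.
move=> hs; have [f homf sE] := section_polynomial hs; exists f => //; split=> //.
have [m [through nzm]] := parabola_through dimL hline.
set g := _ - _ in through.
(* k is the derivative of g at P in the direction of the last coordinate *)
pose k := - (P i0 * (m 0 i2)%:A).
have nzk : k != 0.
  by rewrite oppr_eq0 mulf_neq0 ?coord_neq0 // scaler_eq0 negb_or nzm oner_eq0.
have gE : vertical_line g = k%:P * 'X.
  have := through.2; rewrite /g eval_atB eval_atM.
  rewrite /vertical_line rmorphB rmorphXn !rmorphM /=.
  rewrite -/vertical_line vertical_line_lform !vertical_lineX /= !scale0r !addr0.
  rewrite expr2 eval_atM !eval_atX => g0.
  rewrite /k mulrDr opprD addrA -!polyCM expr2 -polyCM -polyCB g0 add0r mulrA -polyCM.
  by rewrite polyCN mulNr.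
have nzg : g != 0.
  apply: contraTneq isT => g0; have := gE; rewrite g0 /vertical_line raddf0 => /esym/eqP.
  by rewrite mulf_eq0 polyC_eq0 polyX_eq0 (negPf nzk).
have [N [A [_ AN sA]]] := section_denominator i0 hs through nzg.
have AE : A = f * ('X_i0 * g) ^+ N.
  by apply/eqP; rewrite -tofrac_eq -sA sE -tofracM.
have [u uE] := vertical_line_ideal_pow AN.
have : vertical_line f * ((P i0 * k) ^+ N)%:P = 'X * u.
  have nzX : 'X^N != 0 :> {poly L} by rewrite expf_neq0 ?polyX_eq0.
  apply: (mulIf nzX); rewrite [RHS]mulrAC -exprS -add1n -uE AE vertical_lineM.
  have -> : vertical_line (('X_i0 * g) ^+ N) =
      (vertical_line 'X_i0 * vertical_line g) ^+ N.
    by rewrite /vertical_line rmorphXn rmorphM.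
  rewrite gE vertical_lineX /= scale0r addr0 [_%:P * (_ * _)]mulrA -polyCM.
  by rewrite polyC_exp exprMn mulrA.
move=> /(congr1 (fun p : {poly L} => p.[0])).
rewrite !hornerE vertical_line0 ?mul0r => /eqP.
rewrite mulf_eq0 expf_eq0 mulf_eq0 (negPf (coord_neq0 hline i0)) (negPf nzk).
by rewrite !andbF orbF => /eqP.
Qed.

Lemma section_valueE ev kappa f c :
  rational_point P ev -> kappa != 0 ->
  (forall k g, ideal_pow P k g -> ev k g = g.@[fun i => ev 0%N 'X_i] * kappa ^+ k) ->
  form_through P 3 f ->
  section_value P 3 1 ev (tofrac f) c <-> c = f.@[fun i => ev 0%N 'X_i] * kappa.
Proof.
move=> hev nzk evE through; set v := fun i => _.
split=> [[i [b [g [N [A [hg nz [homA hA] fE ->]]]]]]|->].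
  have nzD : ('X_i * g) ^+ N != 0.
    rewrite expf_neq0 // mulf_neq0 ?mpolyX_neq0 //.
    apply: contraNneq nz => g0.
    by rewrite (evE 1%N g (ideal_pow1 hg)) g0 meval0 mul0r mulr0.
  have AE : A = f * ('X_i * g) ^+ N.
    by apply/eqP; rewrite -tofrac_eq tofracM fE divfK ?tofrac_eq0.
  have D0 : ev 0%N 'X_i * ev 1%N g = ('X_i * g).@[v] * kappa.
    by rewrite (evE 1%N g (ideal_pow1 hg)) mevalM mevalXU mulrA.
  have nzD0 : (('X_i * g).@[v] * kappa) ^+ N != 0 by rewrite -D0 expf_neq0.
  rewrite D0 evE // {1}AE mevalM rmorphXn /= exprD expr1.
  apply: (mulIf nzD0); rewrite divfK // exprMn; ring.
have [_ _ _ [i vi] [d [g [hg ev1]]]] := hev.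
exists i, d, g, 0%N, f; rewrite !mul0n !addn0 !expr0 tofrac1 !divr1; split=> //.
- exact: mulf_neq0.
- by split; [case: through|apply: ideal_pow1 through].
by rewrite evE ?expr1 //; apply: ideal_pow1 through.
Qed.

Lemma evaluation_codeE n (pts : 'I_n -> nat -> {mpoly F[3]} -> F) (kappa : 'I_n -> F) :
  (forall i, rational_point P (pts i)) -> (forall i, kappa i != 0) ->
  (forall i k g, ideal_pow P k g ->
     pts i k g = g.@[fun j => pts i 0%N 'X_j] * kappa i ^+ k) ->
  forall c, evaluation_code P 3 1 pts c <->
    exists2 f, form_through P 3 f &
      c = \row_i (f.@[fun j => pts i 0%N 'X_j] * kappa i).
Proof.
move=> hpts nzk ptsE c; split=> [[s /section_cubic[f through ->] cE]|[f through ->]].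
  exists f => //; apply/rowP => i; rewrite mxE.
  exact/(section_valueE _ (hpts i) (nzk i) (ptsE i) through).
exists (tofrac f); first exact: cubic_section.
move=> i; rewrite mxE.
exact/(section_valueE _ (hpts i) (nzk i) (ptsE i) through).
Qed.

End BlowUp.

(** * Zeros of the cubics through the point *)

Section CubicZeros.

Variables (F : finFieldType) (L : fieldExtType F) (P : 'I_3 -> L).
Hypothesis dimL : \dim {:L} = 3%N.
Hypothesis hline : not_on_a_line P.
Local Notation q := #|F|.

Lemma card_zeros_lform (a : 'rV[F]_3) : a != 0 -> #|zeros (lform a)| = (q ^ 2 - 1)%N.
Proof.
move=> nza; have [_ cardH] := card_hyperplane a^T.
rewrite -cardH; last first.
  by apply: contra nza => /eqP/(congr1 trmx); rewrite trmxK trmx0 => ->.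
have h0 : 0 \in hyperplane a^T by rewrite inE mul0mx mxE.
rewrite (cardsD1 0 (hyperplane _)) h0 add1n subn1 /=; apply: eq_card => v.
rewrite !inE meval_lform mxE; congr (_ && (_ == _)).
by apply: eq_bigr => i _; rewrite mxE mulrC.
Qed.

Lemma zerosM (f g : {mpoly F[3]}) : zeros (f * g) \subset zeros f :|: zeros g.
Proof.
apply/subsetP => v; rewrite !inE mevalM mulf_eq0.
by move=> /andP[-> /orP[->|->]]; rewrite ?orbT.
Qed.

Lemma cubic_zeros f : form_through P 3 f -> f != 0 ->
  (#|zeros f| <= 2 * (q ^ 2 - 1))%N.
Proof.
move=> [homf f0] nzf.
have [[a [g [nza fE]]]|//] := linear_factor_or_few_zeros homf.
have nzl : lform a != 0 by rewrite lform_eq0.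
have nzg : g != 0 by apply: contra nzf => /eqP g0; rewrite fE g0 mulr0.
have homg : g \is 2.-homog.
  by apply: (dhomog_cancel nzl (lform_homog a)); rewrite mulrC -fE.
have [[b [h [nzb gE]]]|zg] := linear_factor_or_few_zeros homg; last first.
  rewrite fE; apply: leq_trans (subset_leq_card (zerosM _ _)) _.
  apply: leq_trans (leq_card_setU _ _) _.
  by rewrite card_zeros_lform // mul2n -addnn leq_add2l -[X in (_ <= X)%N]mul1n.
have nzl' : lform b != 0 by rewrite lform_eq0.
have homh : h \is 1.-homog.
  by apply: (dhomog_cancel nzl' (lform_homog b)); rewrite mulrC -gE.
have nzh : h != 0 by apply: contra nzg => /eqP h0; rewrite gE h0 mulr0.
move/eqP: f0; rewrite fE gE !eval_atM !mulf_eq0.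
by rewrite !(negPf (linear_form_neq0 hline _ _)) // ?lform_homog.
Qed.

(** The map [t |-> t^2 - t] takes the same value at 0 and 1, so it is not
    onto; this works in every characteristic. *)
Lemma quadratic_without_root : exists c : F, forall t, t ^+ 2 - t != c.
Proof.
pose phi t : F := t ^+ 2 - t.
have [/forallP onto|/forallPn[c cN]] := boolP [forall c, c \in codom phi]; last first.
  by exists c => t; apply: contra cN => /eqP <-; apply: codom_f.
have /image_injP/(_ 0 1 isT isT) : #|image phi predT| == #|{: F}|.
  by apply/eqP/eq_card => c; rewrite onto.
by rewrite /phi expr0n expr1n !subrr => /(_ erefl)/esym/eqP; rewrite oner_eq0.
Qed.

(** In the coordinates [x = x_0], [y = x_1], [e = m] the conic is [y^2 = x e]; the
    line [e = y + c x] meets it at a point with [x = 0] only if all coordinates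
    vanish, and otherwise where [t = y / x] satisfies [t^2 - t = c], which has no
    solution.  Each of the two curves contains [q^2 - 1] nonzero vectors. *)
Lemma extremal_cubic :
  exists f, [/\ form_through P 3 f, f != 0 & (2 * (q ^ 2 - 1) <= #|zeros f|)%N].
Proof.
have [m [[homg g0] nzm]] := parabola_through dimL hline.
have [c cP] := quadratic_without_root.
pose b : 'rV[F]_3 := m - delta_mx 0 i1 - c *: delta_mx 0 i0.
exists (('X_i1 ^+ 2 - 'X_i0 * lform m) * lform b).
set f := _ * _.
have through : form_through P 3 f.
  split; first exact: dhomogM homg (lform_homog b).
  by rewrite eval_atM g0 mul0r.
(* the vector with given values of x_0, x_1 and m *)
pose pt (x y e : F) : 'rV[F]_3 :=
  \row_j if j == i0 then x else if j == i1 then y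
         else (e - m 0 i0 * x - m 0 i1 * y) / m 0 i2.
have ptm x y e : \sum_j m 0 j * pt x y e 0 j = e.
  by rewrite sum3E !mxE /=; field.
have ptf x y e : f.@[(pt x y e) 0] = (y ^+ 2 - x * e) * (e - y - c * x).
  rewrite /f mevalM mevalB rmorphXn /= mevalM !mevalXU !meval_lform ptm.
  rewrite sum3E !mxE /=; congr (_ * _); field.
  done.
have pt_inj x y e x' y' e' : pt x y e = pt x' y' e' -> [/\ x = x', y = y' & e = e'].
  move=> E; have /rowP E' := E; split; last by rewrite -(ptm x y e) E ptm.
    by have := E' i0; rewrite !mxE.
  by have := E' i1; rewrite !mxE.
have pt0 : pt 0 0 0 = 0.
  by apply/rowP => j; rewrite !mxE; do !case: ifP => _ //; rewrite !mulr0 !subr0 mul0r.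
pose C := [set (if z.1 == 0 then pt 0 0 z.2 else pt z.1 z.2 (z.2 ^+ 2 / z.1)) |
  z : F * F].
pose A := [set pt z.1 z.2 (z.2 + c * z.1) | z : F * F].
have cardC : #|C| = (q ^ 2)%N.
  rewrite card_imset ?card_prod ?mulnn // => -[x y] [x' y'] /=.
  have [->|nx] := eqVneq x 0; have [->|nx'] := eqVneq x' 0.
  - by case/pt_inj => _ _ ->.
  - by case/pt_inj => E; rewrite E eqxx in nx'.
  - by case/pt_inj => E; rewrite E eqxx in nx.
  by case/pt_inj => -> ->.
have cardA : #|A| = (q ^ 2)%N.
  rewrite card_imset ?card_prod ?mulnn // => -[x y] [x' y'] /=.
  by case/pt_inj => -> ->.
have CA : C :&: A \subset [set 0].
  apply/subsetP => v; rewrite !inE => /andP[/imsetP[[x y] _ ->] /imsetP[[x' y'] _]] /=.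
  have [x0|nx] := eqVneq x 0.
    by case/pt_inj => <- <-; rewrite mulr0 addr0 => ->; rewrite pt0.
  case/pt_inj => <- <- E; case/eqP: (cP (y / x)).
  have -> : (y / x) ^+ 2 = (y ^+ 2 / x) / x by field.
  by rewrite E; field.
have sub : (C :|: A) :\ 0 \subset zeros f.
  apply/subsetP => v; rewrite in_setD1 in_setU inE.
  move=> /andP[-> /orP[]] /imsetP[[x y] _ ->] /=.
    have [x0|nx] := eqVneq x 0; rewrite ptf; first by rewrite expr0n mul0r subrr mul0r.
    by apply/eqP; field.
  by rewrite ptf; apply/eqP; ring.
have nzf : f != 0.
  apply: contraTneq isT => f0; have := ptf 0 1 0; rewrite f0 meval0.
  move/eqP; rewrite expr1n mul0r subr0 mul1r mulr0 subr0 sub0r eq_sym oppr_eq0.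
  by rewrite oner_eq0.
split=> //; apply: leq_trans (subset_leq_card sub).
have := cardsD1 0 (C :|: A); have := cardsU C A; have := subset_leq_card CA.
rewrite cards1 cardC cardA.
have : (1 <= q ^ 2)%N by rewrite expn_gt0 (ltnW (finRing_gt1 F)).
move: #|_ :&: _| #|(C :|: A) :\ 0| #|C :|: A| (q ^ 2)%N (0 \in _) => u v w r bb.
lia.
Qed.

End CubicZeros.

(** * Counting projective points by vectors *)

Section Projective.

Variable F : finFieldType.
Local Notation q := #|F|.

(** [v] is a system of representatives of the rational points of the plane, and
    each of them is represented by [q - 1] vectors. *)
Lemma card_scaling_closed (n : nat) (v : 'I_n -> 'rV[F]_3) (A : {set 'rV[F]_3}) :
  (forall i, v i != 0) ->
  (forall i j (la : F), v j = la *: v i -> i = j) ->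
  (forall w : 'rV[F]_3, w != 0 -> exists i (la : F), w = la *: v i) ->
  0 \notin A ->
  (forall (w : 'rV[F]_3) (la : F), la != 0 -> (la *: w \in A) = (w \in A)) ->
  #|A| = (#|[set i | v i \in A]| * (q - 1))%N.
Proof.
move=> nzv vinj vonto A0 Ascale.
have -> : (q - 1 = #|[set~ (0%R : F)]|)%N by rewrite cardsC1 subn1.
rewrite -cardsX -(@card_in_imset _ _ (fun z => z.2 *: v z.1)).
  apply: eq_card => w; apply/idP/imsetP => [wA|[[i la]]].
    have nzw : w != 0 by apply: contra A0 => /eqP <-.
    have [i [la wE]] := vonto w nzw.
    have nzla : la != 0 by apply: contra nzw => /eqP la0; rewrite wE la0 scale0r.
    by exists (i, la); rewrite // !inE /= nzla andbT -(Ascale _ la) // -wE.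
  by rewrite !inE /= => /andP[viA nzla] ->; rewrite Ascale.
move=> [i la] [j mu]; rewrite !inE /= => /andP[_ nzla] /andP[_ nzmu] E.
have ij : i = j.
  by apply: (vinj i j (mu^-1 * la)); rewrite -scalerA E scalerA mulVf // scale1r.
subst j; congr (_, _); apply/eqP; rewrite -subr_eq0.
by move/eqP: E; rewrite -subr_eq0 -scalerBl scaler_eq0 (negPf (nzv i)) orbF.
Qed.

End Projective.

(** * The space of cubics and the code *)

Section CubicSpace.

Variables (F : fieldType) (L : fieldExtType F) (P : 'I_3 -> L).

Definition eval_cubic (f : dhomog 3 F 3) : L := eval_at P (mpoly_of_dhomog f).

Fact eval_cubic_linear : linear eval_cubic.
Proof.
move=> a f g; rewrite /eval_cubic /eval_at linearP /= mmapD mmapZ /=.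
by rewrite mulr_algl.
Qed.

HB.instance Definition _ :=
  GRing.isLinear.Build F (dhomog 3 F 3) L _ eval_cubic eval_cubic_linear.

Definition cubics_through : {vspace dhomog 3 F 3} := lker (linfun eval_cubic).

Lemma mem_cubics_through f :
  (f \in cubics_through) = (eval_at P (mpoly_of_dhomog f) == 0).
Proof. by rewrite memv_ker lfunE. Qed.

Hypothesis dimL : \dim {:L} = 3%N.
Hypothesis hline : not_on_a_line P.

(** The conditions at the three conjugates of P are independent: the cubics
    [x_0^2 l], with [l] linear, already take all values in L. *)
Lemma dim_cubics_through : \dim cubics_through = 7%N.
Proof.
have onto : limg (linfun eval_cubic) = fullv.
  apply/vspaceP => y; rewrite memvf.
  have [a aE] := linear_form_onto dimL hline (y / P i0 ^+ 2).
  have homf : 'X_i0 ^+ 2 * lform a \is 3.-homog.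
    exact: (dhomogM (dhomogMn 2 (homogX F i0)) (lform_homog a)).
  apply/memv_imgP; exists (DHomog homf); rewrite ?memvf // lfunE /= /eval_cubic /=.
  rewrite eval_atM aE expr2 eval_atM eval_atX -expr2 mulrC divfK //.
  by rewrite expf_neq0 ?coord_neq0.
have := limg_ker_dim (linfun eval_cubic) fullv.
rewrite capfv onto dimL dimvf /cubics_through.
by move=> /eqP; rewrite -[X in _ == X]/(7 + 3)%N eqn_add2r => /eqP.
Qed.

Variables (n : nat) (v : 'I_n -> 'I_3 -> F) (kappa : 'I_n -> F).

Definition code_map (f : dhomog 3 F 3) : 'rV[F]_n :=
  \row_i ((mpoly_of_dhomog f).@[v i] * kappa i).

Fact code_map_linear : linear code_map.
Proof.
move=> a f g; apply/rowP => i; rewrite !mxE [mpoly_of_dhomog (_ + _)]linearP /=.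
by rewrite mevalD mevalZ mulrDl mulrA.
Qed.

HB.instance Definition _ :=
  GRing.isLinear.Build F (dhomog 3 F 3) 'rV[F]_n _ code_map code_map_linear.

Definition cubic_code : {vspace 'rV[F]_n} := (linfun code_map @: cubics_through)%VS.

Lemma mem_cubic_code c :
  (exists2 f, form_through P 3 f & c = \row_i (f.@[v i] * kappa i)) <->
  c \in cubic_code.
Proof.
split=> [[f [homf f0] ->]|/memv_imgP[f]].
  apply/memv_imgP; exists (DHomog homf); last by rewrite lfunE.
  by rewrite mem_cubics_through f0.
rewrite mem_cubics_through => /eqP f0 ->; exists (mpoly_of_dhomog f).
  by split=> //; apply: dhomog_is_dhomog.
by rewrite lfunE.
Qed.

End CubicSpace.

Section CodeParameters.

Variables (F : finFieldType) (L : fieldExtType F) (P : 'I_3 -> L).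
Hypothesis dimL : \dim {:L} = 3%N.
Hypothesis hline : not_on_a_line P.
Local Notation q := #|F|.

Lemma rows_enumerated n (pts : 'I_n -> nat -> {mpoly F[3]} -> F)
    (v := fun i => \row_j pts i 0%N 'X_j) :
  enumerates_rational_points P pts ->
  [/\ forall i, v i != 0,
      forall i j (la : F), v j = la *: v i -> i = j
    & forall w : 'rV[F]_3, w != 0 -> exists i (la : F), w = la *: v i].
Proof.
move=> [hpts ptsinj ptsonto].
have nzv i : v i != 0.
  have [_ _ _ [j nzj] _] := hpts i.
  by apply: contra nzj => /eqP/rowP/(_ j); rewrite !mxE => ->.
split=> // [i j la E|w nzw].
  apply: ptsinj; apply/(same_pointP dimL hline) => //; exists la.
    by apply: contra (nzv j) => /eqP la0; rewrite E la0 scale0r.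
  by move=> k; move/rowP/(_ k): E; rewrite !mxE.
have [j nzj] : exists j, w 0 j != 0.
  by apply/rV0Pn.
have hw := rational_point_meval dimL hline nzj.
have [i /(same_pointP dimL hline (hpts i) hw)[la _ E]] := ptsonto _ hw.
by exists i, la; apply/rowP => k; rewrite !mxE -E mevalXU.
Qed.

Lemma card_rational_points n (pts : 'I_n -> nat -> {mpoly F[3]} -> F) :
  enumerates_rational_points P pts -> n = (q ^ 2 + q + 1)%N.
Proof.
move=> /rows_enumerated[nzv vinj vonto].
have := card_scaling_closed nzv vinj vonto (A := [set~ 0]).
rewrite !inE eqxx => /(_ isT); rewrite cardsC1 card_mx mul1n.
rewrite (_ : [set _ | _] = setT) ?cardsT ?card_ord => [E|]; last first.
  by apply/setP => i; rewrite !inE nzv.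
have q1 : (0 < q - 1)%N by rewrite subn_gt0 finRing_gt1.
apply/eqP; rewrite -(eqn_pmul2r q1) -E; last first.
  by move=> w la nzla; rewrite !inE scaler_eq0 (negPf nzla).
rewrite -subn1; apply/eqP; move: (#|F|) q1 => r; case: r => [|r] // _.
rewrite subn1 /= !expnS expn0; nia.
Qed.

Lemma card_zeros_points n (pts : 'I_n -> nat -> {mpoly F[3]} -> F) d f :
  enumerates_rational_points P pts -> f \is d.-homog ->
  #|zeros f| = (#|[set i | f.@[fun j => pts i 0%N 'X_j] == 0%R]| * (q - 1))%N.
Proof.
move=> /rows_enumerated[nzv vinj vonto] homf.
rewrite (card_scaling_closed nzv vinj vonto (A := zeros f)).
- congr (_ * _)%N; apply: eq_card => i; rewrite !inE nzv /=.
  by rewrite (@meval_eq _ _ _ (fun j => pts i 0%N 'X_j)) // => j; rewrite mxE.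
- by rewrite inE eqxx.
move=> w la nzla; rewrite !inE scaler_eq0 (negPf nzla) /=.
have -> : f.@[(la *: w) 0] = la ^+ d * f.@[w 0].
  by rewrite /meval -mmap_scale_homog //; apply: eq_mmap => j; rewrite mxE.
by rewrite mulf_eq0 expf_eq0 (negPf nzla) andbF.
Qed.

(** [rep] chooses one vector on each line through the origin: [pick] depends
    only on the set of multiples of the vector. *)
Lemma enumeration_exists :
  exists n (pts : 'I_n -> nat -> {mpoly F[3]} -> F), enumerates_rational_points P pts.
Proof.
pose rel (v w : 'rV[F]_3) := [exists la : F, (la != 0) && (w == la *: v)].
pose rep v := odflt v [pick w | rel v w].
have relP v : rel v (rep v).
  rewrite /rep; case: pickP => //= /(_ v).
  by move/existsP=> []; exists 1; rewrite oner_eq0 scale1r eqxx.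
have rep_eq v w : rel v w -> rep v = rep w.
  move=> /existsP[la /andP[nzla /eqP ->]]; rewrite /rep.
  have E : rel v =1 rel (la *: v).
    move=> u; apply/existsP/existsP => -[mu /andP[nzmu /eqP ->]].
      exists (mu / la); rewrite mulf_neq0 ?invr_neq0 //= scalerA.
      by rewrite divfK.
    by exists (mu * la); rewrite mulf_neq0 //= scalerA.
  rewrite (eq_pick E); case: pickP => //= /(_ v).
  move=> /existsP[]; exists la^-1.
  by rewrite invr_neq0 //= scalerA mulVf ?scale1r.
pose A := [set v : 'rV[F]_3 | (v != 0) && (rep v == v)].
have nzA (i : 'I_#|A|) : exists j, (enum_val i : 'rV[F]_3) 0 j != 0.
  by apply/rV0Pn; have := enum_valP i; rewrite inE => /andP[].
pose pts (i : 'I_#|A|) (k : nat) (f : {mpoly F[3]}) := f.@[(enum_val i : 'rV[F]_3) 0].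
have hpts i : rational_point P (pts i).
  by have [j nzj] := nzA i; apply: rational_point_meval nzj.
exists #|A|, pts; split=> // [i j|ev hev].
  move=> /(same_pointP dimL hline (hpts i) (hpts j))[la nzla E].
  apply: enum_val_inj.
  have := enum_valP i; rewrite inE => /andP[_ /eqP <-].
  have := enum_valP j; rewrite inE => /andP[_ /eqP <-].
  apply: rep_eq; apply/existsP; exists la; rewrite nzla /=.
  by apply/eqP/rowP => k; have := E k; rewrite /pts !mevalXU mxE.
pose w : 'rV[F]_3 := \row_j ev 0%N 'X_j.
have nzw : w != 0.
  have [_ _ _ [j nzj] _] := hev.
  by apply: contra nzj => /eqP/rowP/(_ j); rewrite !mxE => ->.
have /existsP[la /andP[nzla /eqP repE]] := relP w.
have repA : rep w \in A.
  rewrite inE -(rep_eq _ _ (relP w)) eqxx andbT repE scaler_eq0 (negPf nzla).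
  by rewrite (negPf nzw).
exists (enum_rank_in repA (rep w)).
apply/(same_pointP dimL hline (hpts _) hev); exists la^-1; first by rewrite invr_neq0.
by move=> k; rewrite /pts mevalXU enum_rankK_in // repE !mxE mulKf.
Qed.

Lemma code_parameters n (pts : 'I_n -> nat -> {mpoly F[3]} -> F) :
  enumerates_rational_points P pts ->
  has_parameters (evaluation_code P 3 1 pts) (q ^ 2 + q + 1) 7 (q ^ 2 - q - 1).
Proof.
move=> enumP; have nE := card_rational_points enumP; split=> //.
have q1 : (1 < q)%N := finRing_gt1 F.
have hpts : forall i, rational_point P (pts i) by case: enumP.
have [kappa nzk ptsE] : exists2 kappa : 'I_n -> F, (forall i, kappa i != 0) &
    forall i k f, ideal_pow P k f ->
      pts i k f = f.@[fun j => pts i 0%N 'X_j] * kappa i ^+ k.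
  exact: (fin_all_exists2 (fun i => rational_point_eval dimL hline (hpts i))).
have codeE := evaluation_codeE dimL hline hpts nzk ptsE.
pose v i j := pts i 0%N 'X_j.
pose Z f := [set i | f.@[v i] == 0].
pose word f : 'rV[F]_n := \row_i (f.@[v i] * kappa i).
have weight f : #|[set i | word f 0 i != 0]| = (n - #|Z f|)%N.
  have <- : #|~: Z f| = (n - #|Z f|)%N.
    by have := cardsC (Z f); rewrite card_ord; move: #|Z f| #|~: Z f| => a b; lia.
  apply: eq_card => i.
  by rewrite !inE mxE mulf_eq0 negb_or nzk andbT.
have zerosE f : form_through P 3 f -> #|zeros f| = (#|Z f| * (q - 1))%N.
  by move=> [homf _]; apply: card_zeros_points enumP homf.
have qE : (2 * (q ^ 2 - 1) = (2 * q + 2) * (q - 1))%N.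
  by rewrite -[X in (_ - X)%N](exp1n 2) subn_sqr; lia.
have q1' : (0 < q - 1)%N by rewrite subn_gt0.
have few f : form_through P 3 f -> f != 0 -> (#|Z f| <= 2 * q + 2)%N.
  move=> hf nzf; rewrite -(leq_pmul2r q1') -zerosE // -qE.
  exact: cubic_zeros hf nzf.
have wordB f g : word f - word g = word (f - g).
  by apply/rowP => i; rewrite !mxE mevalB mulrBl.
have distE f g : hamming_dist (word f) (word g) = (n - #|Z (f - g)%R|)%N.
  rewrite -weight; apply: eq_card => i.
  by rewrite !inE -wordB [in RHS]mxE [in X in _ + X]mxE subr_eq0.
have few_lt_n : (2 * q + 2 < n)%N by rewrite nE; move: #|F| q1 => r; nia.
exists (cubic_code P v kappa); split=> [c|||c c'].
- by apply: iff_trans (codeE c) _; apply: mem_cubic_code.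
- rewrite /cubic_code limg_dim_eq ?dim_cubics_through //.
  apply/eqP; rewrite -subv0; apply/subvP => f.
  rewrite memv_cap mem_cubics_through memv_ker lfunE.
  case/andP => /eqP f0 /eqP w0; rewrite memv0 -(inj_eq val_inj) /=.
  apply: contraTT few_lt_n => nzf; rewrite -leqNgt.
  apply: leq_trans (few _ _ nzf); last by split=> //; apply: dhomog_is_dhomog.
  rewrite (_ : Z _ = setT) ?cardsT ?card_ord //.
  apply/setP => i; rewrite !inE; move/rowP/(_ i): w0; rewrite !mxE => /eqP.
  by rewrite mulf_eq0 (negPf (nzk i)) orbF.
- have [f [hf nzf many]] := extremal_cubic dimL hline.
  have h0 : form_through P 3 0 by split; [exact: rpred0|rewrite /eval_at raddf0].
  exists (word f), (word 0).
  have dE : hamming_dist (word f) (word 0) = (q ^ 2 - q - 1)%N.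
    rewrite distE subr0.
    have : (2 * q + 2 <= #|Z f|)%N by rewrite -(leq_pmul2r q1') -zerosE // -qE.
    have := few f hf nzf; move: #|Z f| => z; rewrite nE; move: #|F| => r; nia.
  split=> //; [by apply/mem_cubic_code; exists f|by apply/mem_cubic_code; exists 0|].
  apply: contraTneq q1 => wE; move: dE; rewrite wE /hamming_dist.
  rewrite (_ : [set i | _] = set0) ?cards0; last by apply/setP => i; rewrite !inE eqxx.
  move: #|F| => r; nia.
move=> /mem_cubic_code[f [homf f0] ->] /mem_cubic_code[g [homg g0] ->] ne.
rewrite distE.
have hfg : form_through P 3 (f - g).
  by split; [apply: rpredB|rewrite eval_atB f0 g0 subr0].
have nzfg : f - g != 0 by apply: contra ne => /eqP/subr0_eq ->.
have := few _ hfg nzfg; move: #|Z _| => z; rewrite nE; move: #|F| => r; nia.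
Qed.

End CodeParameters.

Theorem theorem3p8 (F : finFieldType) (L : fieldExtType F) (P : 'I_3 -> L)
    (hdeg : closed_point_of_degree P 3) (hline : not_on_a_line P) :
  let q := #|F| in
  (exists (n : nat) (pts : 'I_n -> nat -> {mpoly F[3]} -> F),
      enumerates_rational_points P pts) /\
  (forall (n : nat) (pts : 'I_n -> nat -> {mpoly F[3]} -> F),
      enumerates_rational_points P pts ->
      has_parameters (evaluation_code P 3 1 pts)
        (q ^ 2 + q + 1) 7 (q ^ 2 - q - 1)).
Proof.
have [dimL _] := hdeg.
split; first exact: enumeration_exists.
by move=> n pts; apply: code_parameters.
Qed.
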